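(* Let $A=\mathbb{Z}^r\oplus\mathbb{Z}_{p_1^{r_1}}\oplus\cdots\oplus\mathbb{Z}_{p_n^{r_n}}$ be a finitely generated abelian group (with $r\ge 0$, the $p_i$ primes and the $r_i$ positive integers). Then there exist a graph $G$ and positive integers $k$ and $\ell$ such that the Eulerian magnitude homology group $EMH_{k,\ell}(G)$ has a subgroup isomorphic to $A$.
   Context: Graphs are finite, simple and undirected. For vertices $a,b$ of $G$, $d(a,b)$ is the least number of edges in a walk from $a$ to $b$ ($\infty$ if there is none, and $d(a,a)=0$). A $k$-path is a tuple $(v_0,\dots,v_k)\in V(G)^{k+1}$ with $v_i\ne v_{i+1}$ and $d(v_i,v_{i+1})<\infty$ for $0\le i\le k-1$; its length is $\mathrm{len}(v_0,\dots,v_k)=\sum_{i=0}^{k-1}d(v_i,v_{i+1})$. It is Eulerian if $v_i\neq v_j$ for all $i\ne j$. $EMC_{k,\ell}(G)$ is the free abelian group on Eulerian $k$-paths of length $\ell$. The differential $\partial_{k,\ell}:EMC_{k,\ell}(G)\to EMC_{k-1,\ell}(G)$ is $\partial_{k,\ell}=\sum_{i=1}^{k-1}(-1)^i\partial^i_{k,\ell}$, where $\partial^i_{k,\ell}(v_0,\dots,v_k)$ is the tuple with $v_i$ deleted if that tuple still has length $\ell$, and $0$ otherwise. $EMH_{k,\ell}(G)=\ker\partial_{k,\ell}/\operatorname{im}\partial_{k+1,\ell}$. *)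

(* Defs.v *)
From HB Require Import structures.
From mathcomp Require Import all_boot all_order all_algebra.
From mathcomp Require Import boolp.

Set Implicit Arguments.
Unset Strict Implicit.
Unset Printing Implicit Defensive.

Import GRing.Theory.
Local Open Scope ring_scope.

(* Finite simple undirected graphs *)

Record sgraph := SGraph {
  vertex :> finType;
  adj : rel vertex;
  adj_sym : symmetric adj;
  adj_irrefl : irreflexive adj }.

Section Distance.
Variable G : sgraph.

Definition walk (n : nat) (a b : G) : bool :=
  [exists p : n.-tuple G, path (@adj G) a p && (last a p == b)].

(* [None] stands for an infinite distance. *)
Definition dist (a b : G) : option nat :=
  if pselect (exists n, walk n a b) is left ex_walk
  then Some (ex_minn ex_walk) else None.

Definition is_kpath (s : seq G) : bool :=
  sorted (fun a b => (a != b) && (dist a b != None)) s.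

(* The default value 0 is only used outside of [is_kpath]. *)
Definition dist0 (a b : G) : nat := odflt 0%N (dist a b).

Definition len (s : seq G) : nat :=
  if s is v :: s' then sumn (pairmap dist0 v s') else 0%N.

End Distance.

(* Eulerian magnitude chains *)

Section EulerianMagnitude.
Variable G : sgraph.

Definition is_epath (l : nat) (s : seq G) : bool :=
  [&& is_kpath s, uniq s & len s == l].

Definition epath (k l : nat) : finType := {v : k.+1.-tuple G | is_epath l v}.

(* The free abelian group on the finite set [epath k l] *)
Definition EMC (k l : nat) : zmodType := {ffun epath k l -> int}.

Definition gen k l (x : epath k l) : EMC k l := [ffun y => (y == x)%:R].

Definition delete (i : nat) (s : seq G) : seq G := take i s ++ drop i.+1 s.

(* A subsequence of an Eulerian path has pairwise distinct vertices at finite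
   distance from each other, so for 0 < i < k the inner [insub] fails
   exactly when the length drops. *)
Definition face k l (i : nat) (x : epath k l) : EMC k.-1 l :=
  if (insub (delete i (val x)) : option (k.-1.+1.-tuple G)) is Some t then
    if (insub t : option (epath k.-1 l)) is Some y then gen y else 0
  else 0.

Definition boundary k l (c : EMC k l) : EMC k.-1 l :=
  \sum_(x : epath k l) (\sum_(1 <= i < k) face i x *~ (-1) ^+ i) *~ c x.

Lemma boundary_is_zmod_morphism k l : zmod_morphism (@boundary k l).
Proof.
move=> c d; rewrite /boundary -sumrB; apply: eq_bigr => x _.
by rewrite !ffunE mulrzBr.
Qed.

HB.instance Definition _ k l :=
  GRing.isZmodMorphism.Build (EMC k l) (EMC k.-1 l) (@boundary k l)
    (@boundary_is_zmod_morphism k l).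

End EulerianMagnitude.

(* Homology *)

Section EulerianMagnitudeHomology.
Variables (G : sgraph) (k l : nat).

Definition cycle_pred : {pred EMC G k l} := fun c => boundary c == 0.

Lemma cycle_pred_zmod_closed : zmod_closed cycle_pred.
Proof.
split=> [|c d]; first by rewrite unfold_in /cycle_pred raddf0.
rewrite !unfold_in => /eqP c0 /eqP d0.
by rewrite raddfB /= c0 d0 subrr.
Qed.

HB.instance Definition _ :=
  GRing.isZmodClosed.Build (EMC G k l) cycle_pred cycle_pred_zmod_closed.

Record cycles := Cycle { cycle_val :> EMC G k l; _ : cycle_val \in cycle_pred }.

HB.instance Definition _ := [isSub for cycle_val].
HB.instance Definition _ := [Choice of cycles by <:].
HB.instance Definition _ := [SubChoice_isSubZmodule of cycles by <:].

(* The codomain [EMC G k.+1.-1 l] of the boundary map is convertible to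
   [EMC G k l]. The image of the boundary map is viewed inside the cycles, which
   contain it because the boundary map squares to zero. *)
Definition bound_pred : {pred cycles} :=
  fun z => `[< exists c : EMC G k.+1 l, boundary c = cycle_val z >].

Lemma bound_pred_zmod_closed : zmod_closed bound_pred.
Proof.
split=> [|y z]; rewrite !unfold_in.
  by apply/asboolP; exists 0; rewrite raddf0.
move=> /asboolP[c Ec] /asboolP[d Ed]; apply/asboolP; exists (c - d).
by rewrite raddfB /= Ec Ed.
Qed.

HB.instance Definition _ :=
  GRing.isZmodClosed.Build cycles bound_pred bound_pred_zmod_closed.

Definition EMH : zmodType := Quotient.quot (bound_pred : zmodClosed cycles).

End EulerianMagnitudeHomology.

(* Finite direct sums of abelian groups *)

Section DirectSum.
Variables (I : finType) (V : I -> zmodType).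

Definition dsum := {dffun forall i : I, V i}.

HB.instance Definition _ := Choice.on dsum.

Definition dsum_zero : dsum := [ffun i : I => (0 : V i)].
Definition dsum_opp (f : dsum) : dsum := [ffun i : I => - f i].
Definition dsum_add (f g : dsum) : dsum := [ffun i : I => f i + g i].

Fact dsum_addA : associative dsum_add.
Proof. by move=> f g h; apply/ffunP=> i; rewrite !ffunE addrA. Qed.
Fact dsum_addC : commutative dsum_add.
Proof. by move=> f g; apply/ffunP=> i; rewrite !ffunE addrC. Qed.
Fact dsum_add0 : left_id dsum_zero dsum_add.
Proof. by move=> f; apply/ffunP=> i; rewrite !ffunE add0r. Qed.
Fact dsum_addN : left_inverse dsum_zero dsum_opp dsum_add.
Proof. by move=> f; apply/ffunP=> i; rewrite !ffunE addNr. Qed.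

HB.instance Definition _ :=
  GRing.isZmodule.Build dsum dsum_addA dsum_addC dsum_add0 dsum_addN.

End DirectSum.

(* Z^r (+) Z/(p 0 ^ e 0) (+) ... (+) Z/(p (n-1) ^ e (n-1)). Beware that ['Z_m]
   is the group of integers modulo m only for m > 1. *)
Definition fg_abelian (r n : nat) (p e : 'I_n -> nat) : zmodType :=
  ('rV[int]_r * dsum (fun i : 'I_n => 'Z_(p i ^ e i)%N : zmodType))%type.

(* B has a subgroup S such that f is an isomorphism from A onto S *)
Definition has_subgroup_isog (B A : zmodType) : Prop :=
  exists (S : zmodClosed B) (f : {additive A -> B}),
    injective f /\ forall y : B, y \in S <-> exists x : A, f x = y.

(* Main.v *)
(* From a matrix f : I -> J -> M over an abelian group M we build a graph with
   five layers source - rows - blocks - columns - sink. Its Eulerian paths of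
   length 4 from the source to the sink form the simplicial complex obtained
   from the complete bipartite graph on rows and columns by coning off, for all
   rows a, a', the set {a, a'} times each level set of f a - f a'. Hence the
   4-cycle on the rows a, a' and the columns c, c' bounds as soon as its
   holonomy f a c - f a' c - f a c' + f a' c' vanishes, and f itself is an
   M-valued cocycle that detects this holonomy.
   For V finite, take three rows 0, y, x + y whose columns list all pairs (x, y)
   of elements of V: the class z(h) of the 4-cycles with holonomy h is then
   additive in h, because a 4-cycle on the rows 0 and x + y depends only on the
   sums x + y, so z(h) can be shifted to start where z(h') ends. The basis of
   Z^r only needs one more column per basis vector. *)

Require Import Defs.
From HB Require Import structures.
From mathcomp Require Import all_boot all_order all_algebra.
From mathcomp Require Import boolp.

Set Implicit Arguments.
Unset Strict Implicit.
Unset Printing Implicit Defensive.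

Import GRing.Theory.

(** * Distances one and two, and paths made of edges *)

Section Distance.
Variable G : sgraph.
Implicit Types a b c : G.

Lemma dist_walk a b m : dist a b = Some m -> walk m a b.
Proof.
rewrite /dist; case: pselect => // ex_walk [<-].
by case: ex_minnP.
Qed.

Lemma walk_dist n a b :
  walk n a b -> exists2 m, dist a b = Some m & m <= n.
Proof.
move=> ab; rewrite /dist; case: pselect => [ex_walk|[]]; last by exists n.
by eexists; first by []; case: ex_minnP => m _; apply.
Qed.

Lemma walk0 a b : walk 0 a b = (a == b).
Proof.
apply/existsP/idP => [[p]|ab]; first by rewrite tuple0.
by exists [tuple].
Qed.

Lemma walk1 a b : walk 1 a b = adj a b.
Proof.
apply/existsP/idP => [[[[|c [|//]] //= _]]|ab].
  by rewrite andbT => /andP[ac /eqP <-].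
by exists [tuple b]; rewrite /= ab eqxx.
Qed.

Lemma walk2 a b c : adj a b -> adj b c -> walk 2 a c.
Proof.
by move=> ab bc; apply/existsP; exists [tuple b; c]; rewrite /= ab bc eqxx.
Qed.

Lemma adj_neq a b : adj a b -> a != b.
Proof. by apply: contraTneq => ->; rewrite adj_irrefl. Qed.

Lemma dist_adj a b : adj a b -> dist a b = Some 1.
Proof.
move=> ab; have /walk_dist[[|[|//]] dab _] : walk 1 a b by rewrite walk1.
  by have:= dist_walk dab; rewrite walk0 (negbTE (adj_neq ab)).
by [].
Qed.

Lemma dist_two a b c :
  a != c -> ~~ adj a c -> adj a b -> adj b c -> dist a c = Some 2.
Proof.
move=> neq_ac nadj_ac ab bc.
have [[|[|[|//]]] dac _] := walk_dist (walk2 ab bc); have:= dist_walk dac.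
- by rewrite walk0 (negbTE neq_ac).
- by rewrite walk1 (negbTE nadj_ac).
by [].
Qed.

Lemma dist0_gt0 a b : a != b -> dist a b != None -> 0 < dist0 a b.
Proof.
rewrite /dist0; case dab: (dist a b) => [[|m]|] //= neq_ab.
by have:= dist_walk dab; rewrite walk0 (negbTE neq_ab).
Qed.

Lemma dist0_adj a b : dist0 a b = 1 -> adj a b.
Proof.
rewrite /dist0; case dab: (dist a b) => [m|] //= m1.
by rewrite -walk1 -m1; apply: dist_walk.
Qed.

(** Four positive distances with sum 4 are all equal to 1. *)
Lemma epath_adj (v0 v1 v2 v3 v4 : G) : is_epath 4 [:: v0; v1; v2; v3; v4] ->
  [/\ adj v0 v1, adj v1 v2, adj v2 v3 & adj v3 v4].
Proof.
case/and3P=> /=; rewrite andbT.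
case/and4P=> /andP[n1 f1] /andP[n2 f2] /andP[n3 f3] /andP[n4 f4] _ /eqP len4.
move: (dist0_gt0 n1 f1) (dist0_gt0 n2 f2) (dist0_gt0 n3 f3) (dist0_gt0 n4 f4).
move=> d1 d2 d3 d4; split; apply: dist0_adj; move: len4 d1 d2 d3 d4;
by case: (dist0 v0 v1) (dist0 v1 v2) (dist0 v2 v3) (dist0 v3 v4)
  => [|[|?]] [|[|?]] [|[|?]] [|[|?]] //=; rewrite ?(addnS, addSn).
Qed.

End Distance.

(** * Basis chains and the evaluation of cochains *)

Section Chains.
Local Open Scope ring_scope.
Variable G : sgraph.

(** With the value 0 outside Eulerian paths of length [l], every face is the [chain] of a shortened
    list, whether or not its length drops. *)
Definition chain k l (s : seq G) : EMC G k l :=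
  if (insub s : option (k.+1.-tuple G)) is Some t then
    if (insub t : option (epath G k l)) is Some x then gen x else 0
  else 0.

Variant chain_spec k l (s : seq G) : EMC G k l -> Prop :=
| ChainGen (x : epath G k l) of tval (val x) = s : chain_spec s (gen x).

Lemma chainP k l (s : seq G) :
  size s = k.+1 -> is_epath l s -> chain_spec s (chain k l s).
Proof.
move=> /eqP size_s epath_s; rewrite /chain insubT.
rewrite insubT; exact: ChainGen.
Qed.

Lemma boundary_gen k l (x : epath G k l) :
  boundary (gen x) =
    \sum_(1 <= i < k) chain k.-1 l (delete i (val x)) *~ (-1) ^+ i.
Proof.
rewrite /boundary (bigD1 x) //= [X in _ + X]big1 => [|y neq_yx].
  by rewrite /gen ffunE eqxx mulr1z addr0.
by rewrite /gen ffunE (negbTE neq_yx) mulr0z.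
Qed.

Lemma boundary_chain k l (s : seq G) : size s = k.+1 -> is_epath l s ->
  boundary (chain k l s) =
    \sum_(1 <= i < k) chain k.-1 l (delete i s) *~ (-1) ^+ i.
Proof. by move=> ? ?; case: chainP => // x <-; apply: boundary_gen. Qed.

Variables (M : zmodType) (w : seq G -> M).

Definition eval k l (c : EMC G k l) : M :=
  \sum_(x : epath G k l) w (val x) *~ c x.

Fact eval_is_zmod_morphism k l : zmod_morphism (@eval k l).
Proof.
move=> c d; rewrite /eval -sumrB; apply: eq_bigr => x _.
by rewrite !ffunE mulrzBr.
Qed.

HB.instance Definition _ k l :=
  GRing.isZmodMorphism.Build (EMC G k l) M (@eval k l)
    (@eval_is_zmod_morphism k l).

Lemma eval_gen k l (x : epath G k l) : eval (gen x) = w (val x).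
Proof.
rewrite /eval (bigD1 x) //= [X in _ + X]big1 => [|y neq_yx].
  by rewrite /gen ffunE eqxx mulr1z addr0.
by rewrite /gen ffunE (negbTE neq_yx) mulr0z.
Qed.

Lemma eval_chain k l (s : seq G) :
  size s = k.+1 -> is_epath l s -> eval (chain k l s) = w s.
Proof. by move=> ? ?; case: chainP => // x <-; apply: eval_gen. Qed.

Lemma eval_chain_eq0 k l (s : seq G) : w s = 0 -> eval (chain k l s) = 0.
Proof.
move=> w0; rewrite /chain; case: insubP => [t _ def_t|_]; last exact: raddf0.
case: insubP => [x _ def_x|_]; last exact: raddf0.
by rewrite eval_gen def_x def_t.
Qed.

Lemma eval_boundary_eq0 k l :
    (forall x : epath G k l, eval (boundary (gen x)) = 0) ->
  forall c : EMC G k l, eval (boundary c) = 0.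
Proof.
move=> w0 c; rewrite /boundary raddf_sum big1 // => x _.
have:= w0 x; rewrite boundary_gen raddfMz => ev0.
by rewrite [X in X *~ _]ev0 mul0rz.
Qed.

End Chains.

(** * Equality of homology classes *)

Section Homology.
Local Open Scope ring_scope.
Local Open Scope quotient_scope.
Variables (G : sgraph) (k l : nat).
Implicit Types y z : cycles G k l.

Lemma pi_homologous y z :
  (exists c : EMC G k.+1 l, boundary c = cycle_val y - cycle_val z) <->
  \pi_(EMH G k l) y = \pi_(EMH G k l) z.
Proof.
transitivity (y - z \in @bound_pred G k l).
  by split=> [hom|/asboolP]; first exact/asboolP.
split=> [yz|/eqP]; last by rewrite -Quotient.idealrBE.
by apply/eqP; rewrite -Quotient.idealrBE.
Qed.

End Homology.

Lemma subr_subACA (V : zmodType) (a b c d : V) :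
  (a - b - (c - d) = (a - c) - (b - d))%R.
Proof. by rewrite opprD addrACA -opprD. Qed.

(** * The layered graph of a matrix, its flags and its cocycle *)

Section BlockGraph.
Local Open Scope ring_scope.
Local Open Scope quotient_scope.
Variables (I J : finType) (M : zmodType) (f : I -> J -> M).

(* [Block a1 a2 c0] stands for the level set of f a1 - f a2 through c0; several
   triples may name the same level set, which is harmless. *)
Inductive vtx := Src | Row of I | Block of I & I & J | Col of J | Snk.

Definition vtx_code (v : vtx) : bool + I + (I * I * J + J) :=
  match v with
  | Src => inl (inl true)
  | Snk => inl (inl false)
  | Row a => inl (inr a)
  | Block a1 a2 c => inr (inl (a1, a2, c))
  | Col c => inr (inr c)
  end.

Definition vtx_decode (s : bool + I + (I * I * J + J)) : vtx :=
  match s with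
  | inl (inl b) => if b then Src else Snk
  | inl (inr a) => Row a
  | inr (inl (a1, a2, c)) => Block a1 a2 c
  | inr (inr c) => Col c
  end.

Lemma vtx_codeK : cancel vtx_code vtx_decode.
Proof. by case. Qed.

HB.instance Definition _ := Finite.copy vtx (can_type vtx_codeK).

Definition link (u v : vtx) : bool :=
  match u, v with
  | Src, Row _ => true
  | Row a, Block a1 a2 _ => (a == a1) || (a == a2)
  | Block a1 a2 c0, Col c => f a1 c - f a2 c == f a1 c0 - f a2 c0
  | Col _, Snk => true
  | _, _ => false
  end.

Definition block_adj (u v : vtx) : bool := link u v || link v u.

Lemma block_adj_sym : symmetric block_adj.
Proof. by move=> u v; rewrite /block_adj orbC. Qed.

Lemma block_adj_irrefl : irreflexive block_adj.
Proof. by case. Qed.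

Definition block_graph : sgraph := SGraph block_adj_sym block_adj_irrefl.

Definition flag a a1 a2 c0 c : seq block_graph :=
  [:: Src; Row a; Block a1 a2 c0; Col c; Snk].

Section Flag.
Variables (a a1 a2 : I) (c0 c : J).
Hypothesis ab : link (Row a) (Block a1 a2 c0).
Hypothesis bc : link (Block a1 a2 c0) (Col c).

Let V (v : vtx) : block_graph := v.
Let b := V (Block a1 a2 c0).

Let sa_adj : adj (V Src) (V (Row a)). Proof. by []. Qed.
Let ab_adj : adj (V (Row a)) b. Proof. by rewrite /= /block_adj ab. Qed.
Let bc_adj : adj b (V (Col c)). Proof. by rewrite /= /block_adj bc. Qed.
Let cs_adj : adj (V (Col c)) (V Snk). Proof. by []. Qed.

Let sa := dist_adj sa_adj.
Let ab1 := dist_adj ab_adj.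
Let bc1 := dist_adj bc_adj.
Let cs := dist_adj cs_adj.

(** Vertices two layers apart on a flag are not adjacent but share a neighbour. So deleting one
    inner vertex keeps the length 4, and all three inner faces survive in [boundary_flag]. *)
Let sb : dist (V Src) b = Some 2.
Proof. by apply: dist_two sa_adj ab_adj. Qed.
Let ac : dist (V (Row a)) (V (Col c)) = Some 2.
Proof. by apply: dist_two ab_adj bc_adj. Qed.
Let bs : dist b (V Snk) = Some 2.
Proof. by apply: dist_two bc_adj cs_adj. Qed.

Lemma epath_flag : is_epath 4 (flag a a1 a2 c0 c).
Proof.
apply/and3P; split; last 1 first.
- by rewrite /= /dist0 sa ab1 bc1 cs.
- by rewrite /is_kpath /= sa ab1 bc1 cs.
by [].
Qed.

Lemma epath_row_block : is_epath 4 [:: V Src; V (Row a); b; V Snk].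
Proof.
apply/and3P; split; last 1 first.
- by rewrite /= /dist0 sa ab1 bs.
- by rewrite /is_kpath /= sa ab1 bs.
by [].
Qed.

Lemma epath_block_col : is_epath 4 [:: V Src; b; V (Col c); V Snk].
Proof.
apply/and3P; split; last 1 first.
- by rewrite /= /dist0 sb bc1 cs.
- by rewrite /is_kpath /= sb bc1 cs.
by [].
Qed.

Lemma epath_row_col : is_epath 4 [:: V Src; V (Row a); V (Col c); V Snk].
Proof.
apply/and3P; split; last 1 first.
- by rewrite /= /dist0 sa ac cs.
- by rewrite /is_kpath /= sa ac cs.
by [].
Qed.
End Flag.

Local Notation chain := (@chain block_graph).

Lemma boundary_flag a a1 a2 c0 c :
    link (Row a) (Block a1 a2 c0) -> link (Block a1 a2 c0) (Col c) ->
  boundary (chain 4 4 (flag a a1 a2 c0 c)) =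
    chain 3 4 [:: Src; Row a; Col c; Snk]
    - (chain 3 4 [:: Src; Block a1 a2 c0; Col c; Snk]
       + chain 3 4 [:: Src; Row a; Block a1 a2 c0; Snk]).
Proof.
move=> ab bc; rewrite boundary_chain ?epath_flag //.
rewrite 3?big_ltn // big_geq // !exprS expr0 !mulr1 !mulN1r opprK mulr1z.
by rewrite !mulrN1z /= addr0 opprD addrCA.
Qed.

(* This is a cocycle because f a c = h b c + g a b on every flag a - b - c, with
   g a b = f a c0 and h b c = f a1 c - f a1 c0 for b = Block a1 a2 c0. *)
Definition weight (s : seq block_graph) : M :=
  match s with
  | [:: Src; Row a; Col c; Snk] => f a c
  | [:: Src; Row a; Block _ _ c0; Snk] => f a c0
  | [:: Src; Block a1 _ c0; Col c; Snk] => f a1 c - f a1 c0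
  | _ => 0
  end.

Lemma weight_flag a a1 a2 c0 c :
    link (Row a) (Block a1 a2 c0) -> link (Block a1 a2 c0) (Col c) ->
  f a c = f a1 c - f a1 c0 + f a c0.
Proof.
move=> /orP[/eqP->|/eqP->] /eqP bc; first by rewrite subrK.
move/eqP: bc; rewrite subr_eq -addrA => /eqP->.
by rewrite [_ + (_ + _)]addrC addrK addrAC addNr add0r.
Qed.

Lemma weight_neq0 (v0 u v v4 : block_graph) :
  weight [:: v0; u; v; v4] != 0 -> v0 = Src /\ v4 = Snk.
Proof.
by case: v0 u v v4 => [|?|? ? ?|?|] [|?|? ? ?|?|] [|?|? ? ?|?|] [|?|? ? ?|?|];
  rewrite /= ?eqxx.
Qed.

Lemma eval_weight_boundary (c : EMC block_graph 4 4) :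
  eval weight (boundary c) = 0.
Proof.
move: c; apply: eval_boundary_eq0 => x; rewrite boundary_gen.
case: x => [[[|v0 [|v1 [|v2 [|v3 [|v4 [|//]]]]]] //= size_s] epath_s].
have [a01 a12 a23 a34] := epath_adj epath_s.
(* Deleting an inner vertex keeps both ends, so with other ends every face has weight 0. *)
have [[def0 def4]|not_ends] := pselect (v0 = Src /\ v4 = Snk); last first.
  rewrite raddf_sum big1_seq // => i; rewrite andTb mem_index_iota => i123.
  rewrite raddfMz [X in X *~ _]eval_chain_eq0 ?mul0rz //.
  apply/eqP/negPn/negP.
  by move: i i123 => [|[|[|[|//]]]] //= _ /weight_neq0.
move: a01 a34 size_s epath_s; rewrite {}def0 {}def4 => a01 a34 size_s epath_s.
(* Only rows are adjacent to the source and only columns to the sink; a common neighbour of a row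
   and a column is a block. The path is therefore a flag. *)
case: v1 => // a in a01 a12 epath_s *; case: v3 => // c in a23 a34 epath_s *.
case: v2 => // a1 a2 c0 in a12 a23 epath_s *.
have ab : link (Row a) (Block a1 a2 c0) by rewrite -[link _ _]orbF.
have bc : link (Block a1 a2 c0) (Col c) by rewrite -[link _ _]orbF.
have bd := @boundary_chain _ 4 4 (flag a a1 a2 c0 c) erefl epath_s.
rewrite -[X in eval weight X]bd boundary_flag // !(raddfB, raddfD) /=.
rewrite !eval_chain ?(epath_row_col ab bc) ?(epath_row_block ab bc)
  ?(epath_block_col ab bc) //=.
by rewrite -opprD -(weight_flag ab bc) subrr.
Qed.

(** * Edges, bands and squares, with their homology classes *)

Definition brim a c : EMC block_graph 3 4 :=
  chain 3 4 [:: Src; Row a; Col c; Snk].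

Lemma epath_brim a c :
  is_epath 4 ([:: Src; Row a; Col c; Snk] : seq block_graph).
(* [Block a a c] joins row [a] to every column, because [f a - f a] is constant. *)
Proof. by apply: (@epath_row_col a a a c c); rewrite /= ?eqxx. Qed.

Lemma eval_brim a c : eval weight (brim a c) = f a c.
Proof. by rewrite eval_chain ?epath_brim. Qed.

Lemma boundary_brim a c : boundary (brim a c) =
  chain 2 4 [:: Src; Row a; Snk] - chain 2 4 [:: Src; Col c; Snk].
Proof.
rewrite boundary_chain ?epath_brim //.
rewrite 2?big_ltn // big_geq // !exprS expr0 !mulr1 !mulN1r opprK mulr1z.
by rewrite !mulrN1z /= addr0 addrC.
Qed.

(** In the simplicial complex, this is the two-edge path between rows [a] and [a'] through column
    [c]. *)
Definition band a a' c := brim a c - brim a' c.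

Definition homologous (z z' : EMC block_graph 3 4) : Prop :=
  exists c : EMC block_graph 4 4, boundary c = z - z'.

Lemma band_homologous a a' c c' :
  f a c - f a' c = f a c' - f a' c' -> homologous (band a a' c) (band a a' c').
Proof.
move=> eq_f; pose F i j := chain 4 4 (flag i a a' c' j).
exists ((F a c - F a' c) - (F a c' - F a' c')).
(* Coning from the block pushes a band onto the path between the two rows through that block, which
   does not depend on the column [c1]. *)
have Ea c1 : f a c1 - f a' c1 = f a c' - f a' c' ->
  boundary (F a c1 - F a' c1) = band a a' c1
    - (chain 3 4 [:: Src; Row a; Block a a' c'; Snk]
       - chain 3 4 [:: Src; Row a'; Block a a' c'; Snk]).
  move=> /eqP Ec1.
  rewrite raddfB /= /F !boundary_flag /= ?eqxx ?orbT //; try exact: Ec1.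
  by rewrite subr_subACA; congr (_ - _); rewrite opprD addrACA subrr add0r.
by rewrite raddfB /= !Ea // subr_subACA subrr subr0.
Qed.

Lemma boundary_band a a' c : boundary (band a a' c) =
  chain 2 4 [:: Src; Row a; Snk] - chain 2 4 [:: Src; Row a'; Snk].
Proof. by rewrite raddfB /= !boundary_brim subr_subACA subrr subr0. Qed.

Definition square a a' c c' : EMC block_graph 3 4 := band a a' c - band a a' c'.

Lemma square_cycle a a' c c' : square a a' c c' \in @cycle_pred block_graph 3 4.
Proof. by apply/eqP; rewrite raddfB /= !boundary_band subrr. Qed.

Definition square_class a a' c c' : EMH block_graph 3 4 :=
  \pi_(EMH block_graph 3 4) (Cycle (square_cycle a a' c c')).

Lemma square_class_shift a a' c c' d d' :
    f a c - f a' c = f a d - f a' d -> f a c' - f a' c' = f a d' - f a' d' ->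
  square_class a a' c c' = square_class a a' d d'.
Proof.
move=> /band_homologous[e Ee] /band_homologous[e' Ee'].
by apply/pi_homologous; exists (e - e'); rewrite raddfB /= Ee Ee' subr_subACA.
Qed.

(** The two squares differ by the square on rows [a] and [a'], which bounds by [band_homologous]. *)
Lemma square_class_swap a a' b c c' :
    f a c - f a' c = f a c' - f a' c' ->
  square_class a b c c' = square_class a' b c c'.
Proof.
move=> /band_homologous[e Ee]; apply/pi_homologous; exists e.
rewrite {}Ee /square /band /= [RHS]subr_subACA.
by congr (_ - _); rewrite subr_subACA subrr subr0.
Qed.

Lemma square_class_chain a a' c c' c'' :
  square_class a a' c c' + square_class a a' c' c'' = square_class a a' c c''.
Proof.
rewrite /square_class -raddfD; congr (\pi_(EMH block_graph 3 4) _).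
apply: val_inj.
by rewrite /= /square addrA subrK.
Qed.

(** * The holonomy homomorphism on homology *)

Definition class_eval (z : EMH block_graph 3 4) : M :=
  eval weight (cycle_val (repr z)).

(** The choice of representative is harmless because the cocycle vanishes on boundaries. *)
Lemma class_eval_pi (z : cycles block_graph 3 4) :
  class_eval (\pi_(EMH block_graph 3 4) z) = eval weight (cycle_val z).
Proof.
have /pi_homologous[c Ec]:
    \pi_(EMH block_graph 3 4) (repr (\pi_(EMH block_graph 3 4) z))
  = \pi_(EMH block_graph 3 4) z by rewrite reprK.
have /eqP := eval_weight_boundary c.
by rewrite Ec raddfB subr_eq0 => /eqP.
Qed.

Lemma class_eval_is_zmod_morphism : zmod_morphism class_eval.
Proof.
move=> y z; rewrite -[y]reprK -[z]reprK -raddfB !class_eval_pi.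
exact: raddfB.
Qed.

HB.instance Definition _ :=
  GRing.isZmodMorphism.Build (EMH block_graph 3 4) M class_eval
    class_eval_is_zmod_morphism.

Lemma class_eval_square a a' c c' : class_eval (square_class a a' c c') =
  (f a c - f a' c) - (f a c' - f a' c').
Proof. by rewrite class_eval_pi /= !raddfB /= !eval_brim. Qed.

End BlockGraph.

(** * The image of an injective homomorphism as a subgroup *)

Section Image.
Local Open Scope ring_scope.
Variables (A B : zmodType) (f : {additive A -> B}).

Definition image_pred : {pred B} := fun y => `[< exists x, f x = y >].

Lemma image_pred_zmod_closed : zmod_closed image_pred.
Proof.
split=> [|y z]; rewrite !unfold_in.
  by apply/asboolP; exists 0; rewrite raddf0.
move=> /asboolP[a <-] /asboolP[b <-]; apply/asboolP.
by exists (a - b); rewrite raddfB.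
Qed.

HB.instance Definition _ :=
  GRing.isZmodClosed.Build B image_pred image_pred_zmod_closed.

Lemma injective_subgroup_isog : injective f -> has_subgroup_isog B A.
Proof.
move=> f_inj; exists (image_pred : zmodClosed B), f; split=> // y.
by split=> /asboolP.
Qed.

End Image.

(** * Embedding the sum of a free group and a finite group *)

Section Embedding.
Local Open Scope ring_scope.
(* H is V seen as a finite type: no structure makes [dsum] both a [zmodType] and
   a [finType]. *)
Variables (r : nat) (H : finType) (V : zmodType) (u : H -> V) (v : V -> H).
Hypothesis vK : cancel v u.

Let M : zmodType := ('rV[int]_r * V)%type.
Let J : finType := (H * H + 'I_r)%type.

Definition first_part (c : J) : M := if c is inl (x, _) then (0, u x) else 0.

Definition second_part (c : J) : M :=
  match c with inl (_, y) => (0, u y) | inr i => (delta_mx 0 i, 0) end.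

(** The rows [None], [Some true] and [Some false] are the rows 0, y and x + y. *)
Definition voltage (a : option bool) (c : J) : M :=
  match a with
  | None => 0
  | Some false => first_part c + second_part c
  | Some true => second_part c
  end.

Local Notation EMHv := (EMH (block_graph voltage) 3 4).

Let entry (x y : V) : J := inl (v x, v y).

Definition torsion_class (h : V) : EMHv :=
  square_class voltage (Some true) None (entry 0 h) (entry 0 0).

Definition free_class (i : 'I_r) : EMHv :=
  square_class voltage (Some true) None (inr i) (entry 0 0).

Lemma torsion_classE (x h : V) : torsion_class h =
  square_class voltage (Some false) None (entry 0 (x + h)) (entry 0 x).
Proof.
(* Rows y and 0 do not see the first coordinate, which can change from 0 to [x]. *)
transitivity
  (square_class voltage (Some true) None (entry x h) (entry x 0)).
  exact: square_class_shift.
(* Rows y and x + y differ by the first coordinate, equal to [x] on both columns, so one can replace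
   the other. *)
transitivity
  (square_class voltage (Some false) None (entry x h) (entry x 0)).
  have diff c : voltage (Some true) c - voltage (Some false) c = - first_part c.
    by rewrite /= opprD addrCA subrr addr0.
  by apply: square_class_swap; rewrite !diff.
(* Rows x + y and 0 see only the sums [x + h] and [x], which can be moved into the second
   coordinate. *)
apply: square_class_shift; rewrite /= !subr0 !vK;
  by congr pair; rewrite ?add0r ?addr0.
Qed.

Lemma torsion_classD : {morph torsion_class : h h' / h + h'}.
Proof.
move=> h h'; rewrite (torsion_classE 0) (torsion_classE 0 h).
(* Started at [h], the square of [h'] runs from [h + h'] to [h]; the square of [h] then runs from
   [h] to 0, and the two telescope. *)
by rewrite (torsion_classE h h') !add0r [RHS]addrC square_class_chain.
Qed.

Definition embedding (m : M) : EMHv :=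
  \sum_i free_class i *~ m.1 0 i + torsion_class m.2.

Fact embedding_is_nmod_morphism : nmod_morphism embedding.
Proof.
have embD : {morph embedding : m m' / m + m'}.
  move=> m m'; rewrite /embedding addrACA -big_split torsion_classD.
  by congr (_ + _); apply: eq_bigr => i _; rewrite mxE mulrzDr.
by split=> //; apply: (addrI (embedding 0)); rewrite -embD !addr0.
Qed.

HB.instance Definition _ :=
  GRing.isNmodMorphism.Build M EMHv embedding embedding_is_nmod_morphism.

(** The base column [entry 0 0] has voltage 0 in the rows used, so the free and torsion squares have
    holonomies [(delta_mx 0 i, 0)] and [(0, h)], from which [m] is read off. *)
Lemma embeddingK : cancel embedding (@class_eval _ _ _ voltage).
Proof.
move=> [w h]; rewrite raddfD raddf_sum /= class_eval_square /=.
have base0 : ((0, u (v 0)) : M) - 0 = 0 by rewrite vK subr0.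
under eq_bigr => i _ do
  rewrite raddfMz /= class_eval_square /= [X in _ - X]base0 !subr0.
rewrite [X in _ - X]base0 !subr0 vK [LHS]surjective_pairing /=.
congr pair.
  rewrite addr0 raddf_sum [RHS]row_sum_delta; apply: eq_bigr => i _.
  by rewrite raddfMz /= -[LHS]scaler_int intz.
by rewrite raddf_sum big1 ?add0r // => i _; rewrite raddfMz /= mul0rz.
Qed.

Lemma free_by_finite_subgroup_isog :
  has_subgroup_isog EMHv (('rV[int]_r * V)%type : zmodType).
Proof. exact: injective_subgroup_isog (can_inj embeddingK). Qed.

End Embedding.

Theorem theorem3p4 (r n : nat) (p e : 'I_n -> nat)
    (p_prime : forall i, prime (p i)) (e_gt0 : forall i, 0 < e i) :
  exists (G : sgraph) (k l : nat),
    [/\ 0 < k, 0 < l & has_subgroup_isog (EMH G k l) (fg_abelian r p e)].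
Proof.
pose V := dsum (fun i : 'I_n => 'Z_(p i ^ e i)%N : zmodType).
(* [H] and [V] have the same elements, so the identity serves in both directions. *)
pose H : finType := {dffun forall i : 'I_n, 'Z_(p i ^ e i)%N}.
pose u (x : H) : V := x; pose v (x : V) : H := x.
have vK : cancel v u by [].
by do 3 eexists; split; last exact: free_by_finite_subgroup_isog vK.
Qed.
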